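(* Let $N$ and $r$ be positive integers and let $n\geq 0$ be an integer. The higher order hypergeometric Bernoulli polynomial $y=B_{N,n}^{(r)}(x)$ satisfies the differential equation $$\frac{B_{N,n}}{n!}y^{(n)}+\frac{B_{N,n-1}}{(n-1)!}y^{(n-1)}+\cdots+\frac{B_{N,2}}{2!}y''-\left(\frac{x}{rN}-\frac{1}{N(N+1)}\right)y'+\frac{n}{rN}y=0,$$ that is, $$\sum_{j=2}^{n}\frac{B_{N,j}}{j!}y^{(j)}-\left(\frac{x}{rN}-\frac{1}{N(N+1)}\right)y'+\frac{n}{rN}y=0,$$ where the sum is empty if $n<2$ and $y^{(j)}$ denotes the $j$-th derivative of $y$ with respect to $x$.
   Context: For positive integers $N,r$, the higher order hypergeometric Bernoulli polynomials $B_{N,n}^{(r)}(x)$ ($n\geq 0$) are defined by the generating function $$\left(\frac{t^N/N!}{e^t-T_{N-1}(t)}\right)^r e^{xt}=\sum_{n=0}^\infty B_{N,n}^{(r)}(x)\frac{t^n}{n!},$$ where $T_{N-1}(t)=\sum_{k=0}^{N-1}\frac{t^k}{k!}$ is the Taylor polynomial of order $N-1$ of the exponential function. (The left-hand side is read as a power series in $t$, since $e^t-T_{N-1}(t)=\frac{t^N}{N!}(1+\cdots)$.) The hypergeometric Bernoulli numbers are $B_{N,n}=B_{N,n}^{(1)}(0)$, i.e. $\frac{t^N/N!}{e^t-T_{N-1}(t)}=\sum_{n=0}^\infty B_{N,n}\frac{t^n}{n!}$. *)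

(* Defs.v *)
From HB Require Import structures.
From mathcomp Require Import all_boot all_order all_algebra.

Set Implicit Arguments.
Unset Strict Implicit.
Unset Printing Implicit Defensive.

Import Order.TTheory GRing.Theory Num.Theory.
Local Open Scope ring_scope.

(* A formal power series over R is represented by its coefficient sequence:
   f : fps R stands for \sum_n (f n) t^n.  Equality of series is [=1].
   The pointwise ring structure that MathComp puts on functions is not the
   one wanted here: products are [fps_mul]. *)
Definition fps (R : Type) := nat -> R.

Section Fps.
Variable R : nzRingType.

Definition fps_mul (f g : fps R) : fps R :=
  fun n => \sum_(i < n.+1) f i * g (n - i)%N.

Definition fps_one : fps R := fun n => (n == 0%N)%:R.

Definition fps_pow (f : fps R) (r : nat) : fps R := iter r (fps_mul f) fps_one.

Definition fps_sub (f g : fps R) : fps R := fun n => f n - g n.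

Definition fps_of_poly (p : {poly R}) : fps R := fun n => p`_n.

End Fps.

Section FpsDiv.
Variable F : fieldType.

(* Quotient f / g of power series when g has order d (i.e. g = c t^d + ...
   with c != 0) and t^d divides f, by long division: the coefficient of
   t^(n + d) in (f / g) * g = f determines the n-th coefficient of f / g.
   [fps_div_prefix d f g n] lists the first n coefficients.
   See [fps_divP]. *)
Fixpoint fps_div_prefix (d : nat) (f g : fps F) (n : nat) : seq F :=
  if n is m.+1 then
    let q := fps_div_prefix d f g m in
    rcons q ((f (m + d)%N - \sum_(i < m) q`_i * g (m + d - i)%N) / g d)
  else [::].

Definition fps_div (d : nat) (f g : fps F) : fps F :=
  fun n => (fps_div_prefix d f g n.+1)`_n.

Lemma size_fps_div_prefix d f g n : size (fps_div_prefix d f g n) = n.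
Proof. by elim: n => //= n IH; rewrite size_rcons IH. Qed.

Lemma nth_fps_div_prefix d f g n i :
  (i < n)%N -> (fps_div_prefix d f g n)`_i = fps_div d f g i.
Proof.
elim: n => // n IH; rewrite ltnS leq_eqVlt => /predU1P[-> // | lt_in].
by rewrite /= nth_rcons size_fps_div_prefix lt_in IH.
Qed.

Lemma fps_divE d f g n :
  fps_div d f g n =
  (f (n + d)%N - \sum_(i < n) fps_div d f g i * g (n + d - i)%N) / g d.
Proof.
rewrite {1}/fps_div /= nth_rcons size_fps_div_prefix ltnn eqxx.
congr ((_ - _) / _); apply: eq_bigr => i _.
by rewrite nth_fps_div_prefix.
Qed.

Lemma fps_mul_order d (q g : fps F) n :
  (forall k, (k < d)%N -> g k = 0) ->
  fps_mul q g (n + d)%N = \sum_(i < n) q i * g (n + d - i)%N + q n * g d.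
Proof.
move=> g0; rewrite /fps_mul -(big_mkord xpredT (fun i => q i * g (n + d - i)%N)).
rewrite (big_cat_nat (n := n.+1)) //=; last by rewrite ltnS leq_addr.
rewrite big_nat_recr //= big_mkord addKn.
suff -> : \sum_(n.+1 <= i < (n + d).+1) q i * g (n + d - i)%N = 0 by rewrite addr0.
rewrite big_nat big1 // => i /andP[lt_ni le_i]; rewrite g0 ?mulr0 //.
by rewrite ltn_subLR // ltn_add2r.
Qed.

Lemma fps_divP d (f g q : fps F) :
    (forall k, (k < d)%N -> f k = 0) ->
    (forall k, (k < d)%N -> g k = 0) -> g d != 0 ->
  fps_mul q g =1 f <-> q =1 fps_div d f g.
Proof.
move=> f0 g0 gd; split=> [qg | qE] n.
  elim/ltn_ind: n => n IH; rewrite fps_divE -qg fps_mul_order //.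
  rewrite (eq_bigr (fun i : 'I_n => fps_div d f g i * g (n + d - i)%N)).
    by rewrite addrAC subrr add0r mulfK.
  by move=> i _; rewrite IH.
have [lt_nd | le_dn] := ltnP n d.
  rewrite f0 // /fps_mul big1 // => i _.
  by rewrite g0 ?mulr0 // (leq_ltn_trans _ lt_nd) ?leq_subr.
rewrite -(subnK le_dn) fps_mul_order // qE fps_divE divfK //.
rewrite (eq_bigr (fun i : 'I_(n - d) =>
  fps_div d f g i * g (n - d + d - i)%N)) ?subrKC //.
by move=> i _; rewrite qE.
Qed.

End FpsDiv.

Section HypergeometricBernoulli.
Variable F : numFieldType.

Definition fps_exp : fps F := fun n => n`!%:R^-1.

(* e^{xt}, as a power series in t over F[x] *)
Definition fps_expX : fps {poly F} := fun n => n`!%:R^-1 *: 'X^n.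

Definition exp_taylor (m : nat) : {poly F} := \poly_(k < m.+1) k`!%:R^-1.

Definition hbern_num (N : nat) : fps F := fps_of_poly (N`!%:R^-1 *: 'X^N).

Definition hbern_den (N : nat) : fps F :=
  fps_sub fps_exp (fps_of_poly (exp_taylor N.-1)).

(* (t^N / N!) / (e^t - T_{N-1}(t)); the denominator has order N. *)
Definition hbern_series (N : nat) : fps F :=
  fps_div N (hbern_num N) (hbern_den N).

Lemma hbern_seriesP N (q : fps F) : (0 < N)%N ->
  fps_mul q (hbern_den N) =1 hbern_num N <-> q =1 hbern_series N.
Proof.
move=> N0; apply: fps_divP => [k ltk | k ltk |].
- by rewrite /hbern_num /fps_of_poly coefZ coefXn (ltn_eqF ltk) mulr0.
- rewrite /hbern_den /fps_sub /fps_exp /fps_of_poly coef_poly prednK // ltk.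
  by rewrite subrr.
rewrite /hbern_den /fps_sub /fps_exp /fps_of_poly coef_poly prednK // ltnn.
by rewrite subr0 invr_eq0 pnatr_eq0 -lt0n fact_gt0.
Qed.

(* B_{N,n}^{(r)}(x) is n! times the coefficient of t^n in the generating
   function, a power series over F[x]. *)
Definition hbern_poly (N r n : nat) : {poly F} :=
  n`!%:R *:
    fps_mul (fps_pow (fun k => (hbern_series N k)%:P) r) fps_expX n.

Definition hbern (N n : nat) : F := (hbern_poly N 1 n).[0].

End HypergeometricBernoulli.

(* Main.v *)
(** Write [f] for the series of the [B_{N,n} / n!], [D] for its denominator and
    [theta = t d/dt].  From [theta D = t D + N (t^N / N!)] and
    [f D = t^N / N!] one gets [theta f = (N - t - N f) f].  Logarithmic
    derivatives add up, so [G = f^r e^(x t)] satisfies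
    [theta G = (r (N - t - N f) + x t) G].  Since [d/dx] acts on [G] as
    multiplication by [t], comparing coefficients of [t^n] is the claim. *)

Require Import Defs.
From mathcomp Require Import all_boot all_order all_algebra.
From mathcomp Require Import ring.

Import Order.TTheory GRing.Theory Num.Theory.
Local Open Scope ring_scope.

(** * Cauchy products of power series and the Euler operator *)

Section FpsTheory.
Set Implicit Arguments.
Unset Strict Implicit.
Variable R : comNzRingType.
Implicit Types f g h k : fps R.

(** The operator [theta]; unlike [d/dt], it does not shift indices. *)
Definition fps_euler f : fps R := fun n => n%:R * f n.

Lemma eq_fps_mul f f' g g' : f =1 f' -> g =1 g' -> fps_mul f g =1 fps_mul f' g'.
Proof. by move=> ff' gg' n; apply: eq_bigr => i _; rewrite ff' gg'. Qed.

(** Low coefficients depend only on truncations, so ring laws carry over from [{poly R}]. *)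
Lemma fps_mul_coef f g m n : (n < m)%N ->
  fps_mul f g n = ((\poly_(i < m) f i) * (\poly_(i < m) g i))`_n.
Proof.
move=> ltnm; rewrite coefM; apply: eq_bigr => i _; rewrite !coef_poly.
have lein : (i <= n)%N by rewrite -ltnS.
by rewrite (leq_ltn_trans lein ltnm) (leq_ltn_trans (leq_subr _ _) ltnm).
Qed.

Lemma fps_mulC f g : fps_mul f g =1 fps_mul g f.
Proof. by move=> n; rewrite !(@fps_mul_coef _ _ n.+1) // mulrC. Qed.

Lemma fps_mulA f g h :
  fps_mul f (fps_mul g h) =1 fps_mul (fps_mul f g) h.
Proof.
move=> n.
pose P u : {poly R} := \poly_(i < n.+1) u i.
have Pcoef u i : (i < n.+1)%N -> u i = (P u)`_i by rewrite coef_poly => ->.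
transitivity (P f * (P g * P h))`_n; last rewrite mulrA.
  rewrite coefM; apply: eq_bigr => i _; rewrite -Pcoef //.
  by rewrite (@fps_mul_coef _ _ n.+1) // ltnS leq_subr.
rewrite coefM; apply: eq_bigr => i _.
by rewrite -(Pcoef h) ?ltnS ?leq_subr // (@fps_mul_coef _ _ n.+1).
Qed.

Lemma fps_mulDl f g h n :
  fps_mul (fun i => f i + g i) h n = fps_mul f h n + fps_mul g h n.
Proof. by rewrite -big_split; apply: eq_bigr => i _; rewrite mulrDl. Qed.

Lemma fps_mulBl f g h n :
  fps_mul (fun i => f i - g i) h n = fps_mul f h n - fps_mul g h n.
Proof. by rewrite -sumrB; apply: eq_bigr => i _; rewrite mulrBl. Qed.

Lemma fps_mulZl c f g n :
  fps_mul (fun i => c * f i) g n = c * fps_mul f g n.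
Proof. by rewrite mulr_sumr; apply: eq_bigr => i _; rewrite mulrA. Qed.

Lemma fps_mul1 f : fps_mul (@fps_one R) f =1 f.
Proof.
move=> n; rewrite /fps_mul big_ord_recl subn0 mul1r big1 ?addr0 // => i _.
by rewrite /fps_one mul0r.
Qed.

Lemma fps_mulX f n :
  fps_mul (fun i => (i == 1%N)%:R) f n = if n is m.+1 then f m else 0.
Proof.
case: n => [|n]; rewrite /fps_mul big_ord_recl mul0r add0r ?big_ord0 //.
rewrite big_ord_recl mul1r /= subSS subn0 big1 ?addr0 // => i _.
by rewrite mul0r.
Qed.

(** The weight [n] splits as [i + (n - i)] in each term of the product. *)
Lemma fps_eulerM f g n : fps_euler (fps_mul f g) n =
  fps_mul (fps_euler f) g n + fps_mul f (fps_euler g) n.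
Proof.
rewrite /fps_euler -big_split mulr_sumr; apply: eq_bigr => i _ /=.
rewrite -{1}(@subnKC i n) -1?ltnS // natrD; ring.
Qed.

(** Here [h] and [k] act as the logarithmic derivatives of [f] and [g]; the product form avoids
    inverting series. *)
Lemma fps_euler_log f g h k :
    fps_euler f =1 fps_mul h f -> fps_euler g =1 fps_mul k g ->
  fps_euler (fps_mul f g) =1 fps_mul (fun i => h i + k i) (fps_mul f g).
Proof.
move=> fh gk n; rewrite fps_eulerM fps_mulDl; congr (_ + _).
  by rewrite (eq_fps_mul fh (frefl _)) fps_mulA.
rewrite (eq_fps_mul (frefl _) gk) fps_mulA.
by rewrite (eq_fps_mul (fps_mulC f k) (frefl _)) -fps_mulA.
Qed.

Lemma fps_euler_log_pow f h r : fps_euler f =1 fps_mul h f ->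
  fps_euler (fps_pow f r) =1 fps_mul (fun i => r%:R * h i) (fps_pow f r).
Proof.
move=> fh; elim: r => [|r IH] n.
  rewrite /fps_euler /fps_mul big1 => [|i _]; last by rewrite !mul0r.
  by case: n => [|n]; rewrite ?mul0r // mulr0.
rewrite (fps_euler_log fh IH); apply: eq_fps_mul => // i.
by rewrite -[in RHS]natr1; ring.
Qed.

End FpsTheory.

Lemma fps_mul_polyC (R : comNzRingType) (f g : fps R) n :
  fps_mul (fun k => (f k)%:P) (fun k => (g k)%:P) n = (fps_mul f g n)%:P.
Proof. by rewrite rmorph_sum; apply: eq_bigr => i _; rewrite /= polyCM. Qed.

Lemma fps_pow_polyC (R : comNzRingType) (f : fps R) r n :
  fps_pow (fun k => (f k)%:P) r n = (fps_pow f r n)%:P.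
Proof.
elim: r n => [|r IH] n; first by rewrite /= /fps_one; case: eqP.
by rewrite -fps_mul_polyC; apply: eq_fps_mul.
Qed.

(** * The logarithmic derivative of the Bernoulli series *)

Section HypergeometricBernoulli.
Variables (F : numFieldType) (N : nat).
Hypothesis N_gt0 : (0 < N)%N.

Local Notation D := (hbern_den F N).
Local Notation M := (hbern_num F N).
Local Notation f := (hbern_series F N).

(** The series [N - t - N f], which will be [theta f / f]. *)
Definition hbern_log : fps F :=
  fun n => N%:R * (n == 0%N)%:R - (n == 1%N)%:R - N%:R * f n.

Lemma fact_neq0 n : (n`!%:R : F) != 0.
Proof. by rewrite pnatr_eq0 -lt0n fact_gt0. Qed.

Lemma succ_invfact n : n.+1%:R * n.+1`!%:R^-1 = n`!%:R^-1 :> F.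
Proof. by rewrite factS natrM invfM mulrA divff ?mul1r // pnatr_eq0. Qed.

Lemma hbern_numE n : M n = N`!%:R^-1 * (n == N)%:R.
Proof. by rewrite /hbern_num /fps_of_poly coefZ coefXn. Qed.

Lemma hbern_denE n : D n = if (n < N)%N then 0 else n`!%:R^-1.
Proof.
rewrite /hbern_den /fps_sub /fps_exp /fps_of_poly coef_poly prednK //.
by case: ifP; rewrite ?subrr ?subr0.
Qed.

Lemma hbern_mul : fps_mul f D =1 M.
Proof. exact/hbern_seriesP. Qed.

(** In [theta D = t D + N M], the monomial [M] is replaced by [f D] to get a multiple of [D]. The
    term [N M] only acts in degree [N], where [t D] is still [0]. *)
Lemma euler_hbern_den :
  fps_euler D =1 fps_mul (fun n => (n == 1%N)%:R + N%:R * f n) D.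
Proof.
move=> n; rewrite fps_mulDl fps_mulZl hbern_mul fps_mulX hbern_numE /fps_euler.
case: n => [|n]; first by rewrite mul0r eq_sym (gtn_eqF N_gt0) !mulr0 addr0.
rewrite !hbern_denE; case: (ltngtP n.+1 N) => [ltnN|ltNn|<-].
- by rewrite !mulr0 add0r.
- by rewrite succ_invfact !mulr0 addr0.
by rewrite mulr1 add0r.
Qed.

(** Since [D] has order exactly [N], long division by it determines the quotient. *)
Lemma hbern_den_inj (p q : fps F) : fps_mul p D =1 fps_mul q D -> p =1 q.
Proof.
have uniq q' : fps_mul q' D =1 fps_mul q D -> q' =1 fps_div N (fps_mul q D) D.
  move=> q'D; apply/fps_divP => // [k ltkN | k ltkN |].
  - rewrite /fps_mul big1 // => i _.
    by rewrite hbern_denE (leq_ltn_trans (leq_subr _ _) ltkN) mulr0.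
  - by rewrite hbern_denE ltkN.
  by rewrite hbern_denE ltnn invr_eq0 fact_neq0.
by move=> pD n; rewrite (uniq _ pD) -(uniq q).
Qed.

Lemma euler_hbern_series : fps_euler f =1 fps_mul hbern_log f.
Proof.
have logD : fps_mul hbern_log D =1 (fun n => N%:R * D n - fps_euler D n).
  move=> n; rewrite euler_hbern_den.
  rewrite (@eq_fps_mul _ _ (fun n => N%:R * fps_one F n -
    ((n == 1%N)%:R + N%:R * f n)) _ D) // => [|i].
    by rewrite fps_mulBl fps_mulZl fps_mul1.
  by rewrite /hbern_log /fps_one; ring.
(* After multiplication by [D] the goal is [theta f * D = N M - f * theta D]: the Leibniz rule for
   [f D = M], with [theta M = N M] as [M] is a monomial of degree [N]. *)
apply: hbern_den_inj => n.
rewrite (eq_fps_mul (fps_mulC _ f) (frefl _)) -fps_mulA.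
rewrite (eq_fps_mul (frefl _) logD) [RHS]fps_mulC fps_mulBl fps_mulZl.
rewrite (fps_mulC D) hbern_mul (fps_mulC (fps_euler D)).
apply/eqP; rewrite eq_sym subr_eq -fps_eulerM /fps_euler hbern_mul.
by rewrite hbern_numE; have [->|_] := eqVneq n N; rewrite ?mulr0.
Qed.

Lemma hbern_series0 : f 0%N = 1.
Proof.
rewrite /hbern_series fps_divE big_ord0 subr0 add0n hbern_numE hbern_denE ltnn eqxx mulr1.
by rewrite divff // invr_eq0 fact_neq0.
Qed.

Lemma hbern_log0 : hbern_log 0%N = 0.
Proof. by rewrite /hbern_log hbern_series0 /=; ring. Qed.

(** As [hbern_log] has no constant term, degree 1 of [theta f = hbern_log * f] reads
    [f 1 = -1 - N * f 1]. *)
Lemma hbern_series1 : f 1%N = - (N%:R + 1)^-1.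
Proof.
have := euler_hbern_series 1%N.
rewrite /fps_euler mul1r /fps_mul big_ord_recl hbern_log0 mul0r add0r.
rewrite big_ord_recl big_ord0 addr0 hbern_series0 mulr1 /hbern_log /= => f1.
have N1 : N%:R + 1 != 0 :> F by rewrite natr1 pnatr_eq0.
apply: (mulIf N1); rewrite mulNr mulVf // mulrDr mulr1 {2}f1; ring.
Qed.

End HypergeometricBernoulli.

(** * Values at [x = 0] and derivatives in [x] *)

Section HypergeometricBernoulliPolynomials.
Variable F : numFieldType.

(** At [x = 0] only the constant term of [e^(x t)] survives. *)
Lemma hbernE N j : hbern F N j / j`!%:R = hbern_series F N j.
Proof.
rewrite /hbern /hbern_poly hornerZ mulrC mulKf ?fact_neq0 //.
rewrite [fps_mul _ _ _](@eq_fps_mul _ _ (fun k => (hbern_series F N k)%:P) _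
  (fps_expX F)) //.
  rewrite /fps_mul big_ord_recr /= subnn hornerD horner_sum big1 ?add0r => [|i _].
    by rewrite /fps_expX hornerM hornerC hornerZ expr0 hornerC invr1 !mulr1.
  rewrite /fps_expX hornerM hornerZ hornerXn expr0n subn_eq0 leqNgt ltn_ord.
  by rewrite !mulr0.
by move=> k /=; rewrite fps_mulC fps_mul1.
Qed.

Lemma deriv_expX n :
  (fps_expX F n)^`() = if n is m.+1 then fps_expX F m else 0.
Proof.
rewrite /fps_expX derivZ derivXn; case: n => [|n]; first by rewrite scaler0.
by rewrite -scaler_nat scalerA mulrC succ_invfact.
Qed.

Lemma euler_expX :
  fps_euler (fps_expX F) =1
  fps_mul (fun n => 'X * (n == 1%N)%:R) (fps_expX F).
Proof.
move=> n; rewrite fps_mulZl fps_mulX /fps_euler; case: n => [|n].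
  by rewrite mul0r mulr0.
rewrite /fps_expX mulr_natl -scaler_nat scalerA succ_invfact.
by rewrite -scalerAr -exprS.
Qed.

Section Coefficients.
Variable c : fps F.
Local Notation a := (fps_mul (fun k => (c k)%:P) (fps_expX F)).

Lemma deriv_mul_expX n : (a n)^`() = if n is m.+1 then a m else 0.
Proof.
rewrite /fps_mul raddf_sum big_ord_recr /= derivM derivC mul0r add0r.
rewrite subnn deriv_expX mulr0 addr0; case: n => [|n]; first by rewrite big_ord0.
apply: eq_bigr => i _; rewrite derivM derivC mul0r add0r deriv_expX.
by rewrite subSn // -ltnS.
Qed.

(** For [j > n] the derivative is [0], whereas truncated subtraction would give [a 0]. *)
Lemma derivn_mul_expX n j : (j <= n)%N -> (a n)^`(j) = a (n - j)%N.
Proof.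
elim: j => [|j IH] ltjn; first by rewrite subn0.
by rewrite derivnS IH ?(ltnW ltjn) // deriv_mul_expX -subnSK.
Qed.

End Coefficients.
End HypergeometricBernoulliPolynomials.

Theorem theorem1p5 (F : numFieldType) (N r n : nat)
    (hN : (0 < N)%N) (hr : (0 < r)%N) :
  let y := hbern_poly F N r n in
  \sum_(2 <= j < n.+1) (hbern F N j / j`!%:R) *: y^`(j)
    - ((r%:R * N%:R)^-1 *: 'X - (N%:R * (N%:R + 1))^-1%:P) * y^`()
    + (n%:R / (r%:R * N%:R)) *: y = 0.
Proof.
move=> y.
pose f := hbern_series F N; pose c := fps_pow f r.
pose a := fps_mul (fun k => (c k)%:P) (fps_expX F).
have yE : y = n`!%:R *: a n.
  rewrite /y /hbern_poly; congr (_ *: _).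
  by apply: eq_fps_mul => // k; apply: fps_pow_polyC.
have rN0 : r%:R * N%:R != 0 :> F by rewrite -natrM pnatr_eq0 -lt0n muln_gt0 hr.
(* The logarithmic derivative of [G]: the first term comes from [f^r], the second from [e^(x t)]. *)
pose k : fps {poly F} := fun i =>
  (r%:R * hbern_log F N i)%:P + 'X * (i == 1%N)%:R.
have rec : n%:R * a n = \sum_(i < n.+1) k i * a (n - i)%N.
  have logc : fps_euler (fun i => (c i)%:P) =1
      fps_mul (fun i => (r%:R * hbern_log F N i)%:P) (fun i => (c i)%:P).
    move=> i; rewrite fps_mul_polyC -fps_euler_log_pow.
      by rewrite /fps_euler rmorphM /= rmorph_nat.
    exact: euler_hbern_series.
  exact: (fps_euler_log logc (@euler_expX F)).
rewrite yE derivZ {2}/a deriv_mul_expX.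
(* For [n = 0] the sum is empty and [y] is constant; otherwise [y'] is a multiple of [a m]. *)
case: n => [|m] in y yE rec *.
  by rewrite big_geq // mul0r scale0r scaler0 mulr0 subr0 addr0.
rewrite -/a.
rewrite (@eq_big_nat _ _ _ _ _ _ (fun j =>
    m.+1`!%:R *: (f j *: a (m.+1 - j)%N))); last first.
  move=> j /andP[_ ltj]; rewrite hbernE derivnZ derivn_mul_expX //.
  by rewrite !scalerA mulrC.
rewrite -scaler_sumr -scalerAr scalerA [_ / _ * _]mulrC -scalerA.
rewrite -scalerBr -scalerDr.
rewrite [X in _ *: X](_ : _ = 0) ?scaler0 //.
(* The terms [N], [t] and [x t] only affect degrees 0 and 1. Thus [k j] for [j >= 2] yields the sum,
   [k 1] the coefficient of [y'], and [k 0 = 0] keeps [a n] off the right side. *)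
have kS (j : nat) : (1 < j)%N -> k j = - (r%:R * N%:R * f j)%:P.
  case: j => [|[|j]] // _; rewrite /k /hbern_log !mulr0 addr0 subr0 sub0r.
  by rewrite mulrN mulrA polyCN.
have k0 : k 0%N = 0 by rewrite /k hbern_log0 // !mulr0 addr0.
have N1 : N%:R + 1 != 0 :> F by rewrite natr1 pnatr_eq0.
have k1 : k 1%N = 'X - (r%:R / (N%:R + 1))%:P.
  rewrite /k /hbern_log hbern_series1 //= mulr0 mulr1 [RHS]addrC -polyCN.
  by congr (_%:P + _); field; exact: N1.
move: rec; rewrite -(big_mkord xpredT (fun i => k i * a (m.+1 - i)%N)).
rewrite big_ltn // big_ltn // k0 mul0r add0r k1 subSS subn0.
rewrite (@eq_big_nat _ _ _ _ _ _ (fun j =>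
    - (r%:R * N%:R) *: (f j *: a (m.+1 - j)%N))); last first.
  by move=> j /andP[lt1j _]; rewrite kS // mulNr mul_polyC scaleNr scalerA.
rewrite -scaler_sumr; set S := \sum_(2 <= j < m.+2) _ => rec.
(* Multiplying by [r N] clears the denominators and turns the goal into [rec]. *)
apply: (scalerI rN0); rewrite scaler0 scalerDr scalerBr scalerA [_ * (_ / _)]mulrC.
rewrite divfK // scaler_nat -(mulr_natl (a m.+1)) rec scaleNr scalerAl.
rewrite scalerBr scalerA divff // scale1r -[_ *: _%:P]mul_polyC -polyCM.
rewrite (_ : r%:R * N%:R * _ = r%:R / (N%:R + 1)); first by ring.
by field; rewrite N1 pnatr_eq0 -lt0n.
Qed.
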